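(* Let $A$ denote the path algebra of a finite Boolean algebra $L$. The functor $$(-_\phi)^*\colon(\mathrm{mod}\text{-}A)^{\mathrm{op}}\to\mathrm{mod}\text{-}A$$ is an equivalence of categories; in particular, $M\in\mathrm{mod}\text{-}A$ is projective if and only if $(M_\phi)^*$ is injective. Furthermore, $A$ is QF-2, and $A$ is quasi-Frobenius if and only if $|L|=1$.
   Context: Fix a field $\Bbbk$. A Boolean algebra is a bounded distributive lattice $(L,\wedge,\vee)$, with maximal element $t$ and minimal element $s$, in which every $a\in L$ has a (necessarily unique) complement $a^\perp$, i.e. $a\vee a^\perp=t$ and $a\wedge a^\perp=s$. The case $s=t$ is allowed. It is a poset via $a\le b\iff a\vee b=b$. Let $\mathcal{L}$ be the corresponding poset-category and $\Bbbk\mathcal{L}$ its linearisation (same objects, $\Bbbk\mathcal{L}(a,b)$ the vector space with basis $\mathcal{L}(a,b)$). The path algebra of $L$ is $A=\bigoplus_{e,f\in L}\Bbbk\mathcal{L}(e,f)$, with product of $f\in\Bbbk\mathcal{L}(a,b)$ and $g\in\Bbbk\mathcal{L}(c,d)$ given by $f\cdot g=g\circ f$ if $b=c$ and $f\cdot g=0$ otherwise. $\mathrm{mod}\text{-}A$ and $A\text{-mod}$ are the categories of finite-dimensional right and left $A$-modules. Taking complements (which reverses the order on $L$) extends to an anti-algebra isomorphism $\phi\colon A\to A$. For a right module $M$, $M_\phi$ is the left module with the same underlying vector space and action $a\triangleright m=m\triangleleft\phi(a)$. For a left module $N$, $N^*$ is the linear dual with its induced right module structure. An algebra is quasi-Frobenius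 if its projective (right) modules are injective and vice versa. It is QF-2 if each indecomposable projective right module and each indecomposable projective left module has a simple socle. *)

(* Defs.v *)
From HB Require Import structures.
From mathcomp Require Import all_boot all_order all_algebra all_field.
From mathcomp Require boolp.

Set Implicit Arguments.
Unset Strict Implicit.
Unset Printing Implicit Defensive.

Import Order.Theory GRing.Theory.
Local Open Scope ring_scope.

Record category := Category {
  obj :> Type;
  mor : obj -> obj -> Type;
  idm : forall X, mor X X;
  compm : forall X Y Z, mor Y Z -> mor X Y -> mor X Z;
  compmA : forall W X Y Z (h : mor Y Z) (g : mor X Y) (f : mor W X),
    compm h (compm g f) = compm (compm h g) f;
  comp1m : forall X Y (f : mor X Y), compm (idm Y) f = f;
  compm1 : forall X Y (f : mor X Y), compm f (idm X) = f }.

Arguments mor {c} X Y.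
Arguments idm {c} X.
Arguments compm {c X Y Z} _ _.

Definition opposite (C : category) : category :=
  @Category C (fun X Y => @mor C Y X) (@idm C) (fun X Y Z g f => compm f g)
    (fun W X Y Z h g f => esym (compmA f g h))
    (fun X Y f => compm1 f) (fun X Y f => comp1m f).

Record functor (C D : category) := Functor {
  fobj :> C -> D;
  fmor : forall X Y : C, mor X Y -> mor (fobj X) (fobj Y);
  fmor1 : forall X : C, fmor (idm X) = idm (fobj X);
  fmorM : forall (X Y Z : C) (g : mor Y Z) (f : mor X Y),
    fmor (compm g f) = compm (fmor g) (fmor f) }.

Arguments fmor {C D} _ {X Y} _.

Definition id_functor (C : category) : functor C C :=
  @Functor C C id (fun X Y f => f) (fun _ => erefl) (fun _ _ _ _ _ => erefl).

Section FunctorOperations.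
Variables C D E : category.

Definition opposite_functor (F : functor C D) :
    functor (opposite C) (opposite D) :=
  @Functor (opposite C) (opposite D) F (fun X Y f => @fmor _ _ F Y X f)
    (fun X => fmor1 F X) (fun X Y Z g f => fmorM F f g).

Variables (G : functor D E) (F : functor C D).

Fact comp_functor1 (X : C) : fmor G (fmor F (idm X)) = idm (G (F X)).
Proof. by rewrite !fmor1. Qed.

Fact comp_functorM (X Y Z : C) (g : mor Y Z) (f : mor X Y) :
  fmor G (fmor F (compm g f)) =
  compm (fmor G (fmor F g)) (fmor G (fmor F f)).
Proof. by rewrite !fmorM. Qed.

Definition comp_functor : functor C E :=
  @Functor C E (fun X => G (F X)) (fun X Y f => fmor G (fmor F f))
    comp_functor1 comp_functorM.

End FunctorOperations.

Definition isomorphism (C : category) (X Y : C) (f : mor X Y) : Prop :=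
  exists2 g : mor Y X, compm g f = idm X & compm f g = idm Y.

Definition naturally_isomorphic (C D : category) (F G : functor C D) : Prop :=
  exists eta : forall X : C, mor (F X) (G X),
    (forall (X Y : C) (f : mor X Y),
       compm (fmor G f) (eta X) = compm (eta Y) (fmor F f)) /\
    (forall X : C, isomorphism (eta X)).

Definition equivalence (C D : category) (F : functor C D) : Prop :=
  exists G : functor D C,
    naturally_isomorphic (comp_functor G F) (id_functor C) /\
    naturally_isomorphic (comp_functor F G) (id_functor D).

Variant side := LeftSide | RightSide.

(* [act M a m] is a |> m for a left module and m <| a for a right module.
   All modules are finite-dimensional: projectivity, injectivity, and with
   them QF and QF-2, are taken in mod-A and A-mod. *)
Record fdmod (K : fieldType) (A : falgType K) (s : side) := FdMod {
  mod_space :> vectType K;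
  act : A -> 'End(mod_space);
  act_linear : linear act;
  act1 : forall m, act 1 m = m;
  actM : forall a b m,
    act (a * b) m = if s is LeftSide then act a (act b m)
                    else act b (act a m) }.

Arguments FdMod {K A} s {mod_space act} _ _ _.
Arguments act {K A s} _ _.

Record fdhom (K : fieldType) (A : falgType K) (s : side) (M N : fdmod A s) :=
  FdHom {
    hom_lfun :> 'Hom(M, N);
    hom_act : forall a m, hom_lfun (act M a m) = act N a (hom_lfun m) }.

Section ModuleCategory.
Variables (K : fieldType) (A : falgType K) (s : side).
Implicit Types M N P : fdmod A s.

Lemma fdhom_inj M N (f g : fdhom M N) : hom_lfun f = hom_lfun g -> f = g.
Proof.
case: f g => [f fP] [g gP] /= eq_fg; case: g / eq_fg gP => gP.
by congr FdHom; apply: boolp.Prop_irrelevance.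
Qed.

Fact fdhom_id_act M a (m : M) : \1%VF (act M a m) = act M a (\1%VF m).
Proof. by rewrite !lfunE. Qed.
Definition fdhom_id M : fdhom M M := FdHom (@fdhom_id_act M).

Fact fdhom_comp_act M N P (g : fdhom N P) (f : fdhom M N) a m :
  (g \o f)%VF (act M a m) = act P a ((g \o f)%VF m).
Proof. by rewrite !comp_lfunE !hom_act. Qed.
Definition fdhom_comp M N P (g : fdhom N P) (f : fdhom M N) : fdhom M P :=
  FdHom (fdhom_comp_act g f).

Fact fdhom_compA M N P Q (h : fdhom P Q) (g : fdhom N P) (f : fdhom M N) :
  fdhom_comp h (fdhom_comp g f) = fdhom_comp (fdhom_comp h g) f.
Proof. by apply: fdhom_inj; rewrite /= comp_lfunA. Qed.

Fact fdhom_comp1m M N (f : fdhom M N) : fdhom_comp (fdhom_id N) f = f.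
Proof. by apply: fdhom_inj; rewrite /= comp_lfun1l. Qed.

Fact fdhom_compm1 M N (f : fdhom M N) : fdhom_comp f (fdhom_id M) = f.
Proof. by apply: fdhom_inj; rewrite /= comp_lfun1r. Qed.

Definition mod_category : category :=
  Category fdhom_compA fdhom_comp1m fdhom_compm1.

Definition projective (P : fdmod A s) : Prop :=
  forall (M N : fdmod A s) (g : fdhom M N) (f : fdhom P N),
    (forall n : N, exists m : M, g m = n) ->
    exists h : fdhom P M, forall p, g (h p) = f p.

Definition injective_mod (I : fdmod A s) : Prop :=
  forall (M N : fdmod A s) (g : fdhom M N) (f : fdhom M I),
    injective g -> exists h : fdhom N I, forall m, h (g m) = f m.

Section Submodules.
Variable M : fdmod A s.

Definition submodule (U : {vspace M}) : Prop :=
  forall a m, m \in U -> act M a m \in U.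

Definition simple_submodule (S : {vspace M}) : Prop :=
  [/\ submodule S, S <> 0%VS &
      forall U, submodule U -> (U <= S)%VS -> U = 0%VS \/ U = S].

Definition indecomposable : Prop :=
  (fullv : {vspace M}) <> 0%VS /\
  forall U V, submodule U -> submodule V ->
    (U + V)%VS = fullv -> (U :&: V)%VS = 0%VS -> U = 0%VS \/ V = 0%VS.

(* The socle is the sum of all simple submodules. *)
Definition in_socle (m : M) : Prop :=
  exists (n : nat) (S : 'I_n -> {vspace M}),
    (forall i, simple_submodule (S i)) /\ m \in (\sum_i S i)%VS.

Definition has_simple_socle : Prop :=
  exists S : {vspace M},
    (forall m, m \in S <-> in_socle m) /\ simple_submodule S.

End Submodules.
End ModuleCategory.

Definition quasi_Frobenius (K : fieldType) (A : falgType K) : Prop :=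
  forall M : fdmod A RightSide, projective M <-> injective_mod M.

Definition QF2 (K : fieldType) (A : falgType K) : Prop :=
  (forall P : fdmod A RightSide,
     projective P -> indecomposable P -> has_simple_socle P) /\
  (forall P : fdmod A LeftSide,
     projective P -> indecomposable P -> has_simple_socle P).

Record anti_automorphism (K : fieldType) (A : falgType K) := AntiAut {
  anti_lfun :> 'End(A);
  anti_bij : bijective anti_lfun;
  anti1 : anti_lfun 1 = 1;
  antiM : forall a b, anti_lfun (a * b) = anti_lfun b * anti_lfun a }.

Section TwistFunctor.
Variables (K : fieldType) (A : falgType K) (phi : anti_automorphism A).

Section Twist.
Variable M : fdmod A RightSide.

Definition twist_act (a : A) : 'End(M) := act M (phi a).

Fact twist_act_linear : linear twist_act.
Proof. by move=> c a b; rewrite /twist_act linearP act_linear. Qed.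

Fact twist_act1 m : twist_act 1 m = m.
Proof. by rewrite /twist_act anti1 act1. Qed.

Fact twist_actM a b m : twist_act (a * b) m = twist_act a (twist_act b m).
Proof. by rewrite /twist_act antiM actM. Qed.

Definition twist : fdmod A LeftSide :=
  FdMod LeftSide twist_act_linear twist_act1 twist_actM.

End Twist.

Fact twist_hom_act (M N : fdmod A RightSide) (f : fdhom M N) a m :
  f (act (twist M) a m) = act (twist N) a (f m).
Proof. exact: hom_act. Qed.

Definition twist_hom (M N : fdmod A RightSide) (f : fdhom M N) :
  fdhom (twist M) (twist N) := @FdHom _ _ _ (twist M) (twist N) f (twist_hom_act f).

Fact twist_hom1 (M : fdmod A RightSide) :
  twist_hom (fdhom_id M) = fdhom_id (twist M).
Proof. exact: fdhom_inj. Qed.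

Fact twist_homM (M N P : fdmod A RightSide) (g : fdhom N P) (f : fdhom M N) :
  twist_hom (fdhom_comp g f) = fdhom_comp (twist_hom g) (twist_hom f).
Proof. exact: fdhom_inj. Qed.

Definition twist_functor :
    functor (mod_category A RightSide) (mod_category A LeftSide) :=
  @Functor (mod_category A RightSide) (mod_category A LeftSide)
    twist twist_hom twist_hom1 twist_homM.

End TwistFunctor.

Section DualFunctor.
Variables (K : fieldType) (A : falgType K).

Section Dual.
Variable N : fdmod A LeftSide.

Definition dual_act (a : A) : 'End('Hom(N, K^o)) :=
  linfun (fun xi : 'Hom(N, K^o) => (xi \o act N a)%VF).

Fact dual_actE a xi : dual_act a xi = (xi \o act N a)%VF.
Proof.
pose f xi : 'Hom(N, K^o) := (xi \o act N a)%VF.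
have f_lin : linear f by move=> c x y; rewrite /f comp_lfunDl comp_lfunZl.
pose fL := GRing.isLinear.Build K 'Hom(N, K^o) 'Hom(N, K^o) _ f f_lin.
pose F : {linear _ -> _} := HB.pack f fL.
exact: (lfunE F).
Qed.

Fact dual_act_linear : linear dual_act.
Proof.
move=> c a b; apply/lfunP=> xi; apply/lfunP=> n.
rewrite add_lfunE scale_lfunE !dual_actE add_lfunE scale_lfunE !comp_lfunE.
by rewrite act_linear add_lfunE scale_lfunE linearP.
Qed.

Fact dual_act1 xi : dual_act 1 xi = xi.
Proof. by apply/lfunP=> n; rewrite dual_actE comp_lfunE act1. Qed.

Fact dual_actM a b xi : dual_act (a * b) xi = dual_act b (dual_act a xi).
Proof. by apply/lfunP=> n; rewrite !dual_actE !comp_lfunE actM. Qed.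

Definition dual : fdmod A RightSide :=
  FdMod RightSide dual_act_linear dual_act1 dual_actM.

End Dual.

Section DualHom.
Variables (M N : fdmod A LeftSide) (f : fdhom M N).

Definition dual_hom_lfun : 'Hom(dual N, dual M) :=
  linfun (fun xi : 'Hom(N, K^o) => (xi \o f)%VF).

Fact dual_hom_lfunE xi : dual_hom_lfun xi = (xi \o f)%VF.
Proof.
pose g (xi : 'Hom(N, K^o)) : 'Hom(M, K^o) := (xi \o f)%VF.
have g_lin : linear g by move=> c x y; rewrite /g comp_lfunDl comp_lfunZl.
pose gL := GRing.isLinear.Build K 'Hom(N, K^o) 'Hom(M, K^o) _ g g_lin.
pose G : {linear _ -> _} := HB.pack g gL.
exact: (lfunE G).
Qed.

Fact dual_hom_act a xi :
  dual_hom_lfun (act (dual N) a xi) = act (dual M) a (dual_hom_lfun xi).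
Proof.
apply/lfunP=> m; rewrite /= !dual_hom_lfunE !dual_actE !comp_lfunE.
by rewrite hom_act.
Qed.

Definition dual_hom : fdhom (dual N) (dual M) := FdHom dual_hom_act.

End DualHom.

Fact dual_hom1 M : dual_hom (fdhom_id M) = fdhom_id (dual M).
Proof.
apply: fdhom_inj; apply/lfunP=> xi.
by rewrite /= dual_hom_lfunE lfunE /= comp_lfun1r.
Qed.

Fact dual_homM (M N P : fdmod A LeftSide) (g : fdhom N P) (f : fdhom M N) :
  dual_hom (fdhom_comp g f) = fdhom_comp (dual_hom f) (dual_hom g).
Proof.
apply: fdhom_inj; apply/lfunP=> xi.
by rewrite /= comp_lfunE !dual_hom_lfunE /= comp_lfunA.
Qed.

Definition dual_functor :
    functor (opposite (mod_category A LeftSide)) (mod_category A RightSide) :=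
  @Functor (opposite (mod_category A LeftSide)) (mod_category A RightSide)
    dual (fun M N f => dual_hom f) dual_hom1 (fun M N P g f => dual_homM f g).

End DualFunctor.

Definition twisted_dual (K : fieldType) (A : falgType K)
    (phi : anti_automorphism A) :
    functor (opposite (mod_category A RightSide)) (mod_category A RightSide) :=
  comp_functor (dual_functor A) (opposite_functor (twist_functor phi)).

Definition arrow (d : Order.disp_t) (L : finCTBDistrLatticeType d) : finType :=
  {p : L * L | (p.1 <= p.2)%O}.

Definition path_algebra (K : fieldType) (d : Order.disp_t)
    (L : finCTBDistrLatticeType d) : Type := {ffun arrow L -> K^o}.

Section PathAlgebra.
Variables (K : fieldType) (d : Order.disp_t) (L : finCTBDistrLatticeType d).
Local Notation A := (path_algebra K L).
Implicit Types (p q r : arrow L) (x y z : A).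

HB.instance Definition _ := Vector.on A.

Definition src p : L := (val p).1.
Definition tgt p : L := (val p).2.

Lemma arrow_le p : (src p <= tgt p)%O. Proof. exact: (valP p). Qed.

(* The basis vector of the arrow a -> b; it is 0 when a <= b fails. *)
Definition path_gen (a b : L) : A := [ffun r => (val r == (a, b))%:R].

Definition path_one : A := \sum_(a : L) path_gen a a.

(* Paths compose from left to right: (a -> b) * (b -> c) = (a -> c). *)
Definition path_mul x y : A :=
  \sum_p \sum_q (x p * y q) *:
    (if tgt p == src q then path_gen (src p) (tgt q) else 0).

Lemma path_genE p r : path_gen (src p) (tgt p) r = (r == p)%:R.
Proof. by rewrite ffunE -val_eqE /src /tgt; case: (val p). Qed.

Lemma path_decomp x : x = \sum_p x p *: path_gen (src p) (tgt p).
Proof.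
apply/ffunP=> r; rewrite sum_ffunE (bigD1 r) //= big1 ?addr0.
  by rewrite ffunE path_genE eqxx [_ *: _]mulr1.
by move=> p /negPf pr; rewrite ffunE path_genE eq_sym pr [_ *: _]mulr0.
Qed.

Lemma path_gen_mul (a b c e : L) : (a <= b)%O -> (c <= e)%O ->
  path_mul (path_gen a b) (path_gen c e) = if b == c then path_gen a e else 0.
Proof.
move=> ab ce; pose p : arrow L := exist _ (a, b) ab.
pose q : arrow L := exist _ (c, e) ce.
rewrite -[path_gen a b]/(path_gen (src p) (tgt p)).
rewrite -[path_gen c e]/(path_gen (src q) (tgt q)).
rewrite /path_mul (bigD1 p) //= (bigD1 q) //= big1 ?addr0 => [|q' qq'].
  rewrite big1 ?addr0 => [|p' /negPf pp'].
    by rewrite !path_genE !eqxx mulr1 scale1r.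
  by rewrite big1 // => q' _; rewrite path_genE pp' mul0r scale0r.
by rewrite [X in _ * X]path_genE (negPf qq') mulr0 scale0r.
Qed.

Lemma path_mulDl : left_distributive path_mul +%R.
Proof.
move=> x y z; rewrite /path_mul -big_split; apply: eq_bigr => p _ /=.
rewrite -big_split; apply: eq_bigr => q _ /=.
by rewrite ffunE mulrDl scalerDl.
Qed.

Lemma path_mulDr : right_distributive path_mul +%R.
Proof.
move=> x y z; rewrite /path_mul -big_split; apply: eq_bigr => p _ /=.
rewrite -big_split; apply: eq_bigr => q _ /=.
by rewrite ffunE mulrDr scalerDl.
Qed.

Lemma path_scaleAl c x y : c *: path_mul x y = path_mul (c *: x) y.
Proof.
rewrite /path_mul scaler_sumr; apply: eq_bigr => p _ /=.
rewrite scaler_sumr; apply: eq_bigr => q _ /=.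
by rewrite ffunE scalerA mulrA.
Qed.

Lemma path_scaleAr c x y : c *: path_mul x y = path_mul x (c *: y).
Proof.
rewrite /path_mul scaler_sumr; apply: eq_bigr => p _ /=.
rewrite scaler_sumr; apply: eq_bigr => q _ /=.
by rewrite ffunE scalerA [_ *: y q]mulrC mulrA [y q * c]mulrC mulrCA mulrA.
Qed.

Lemma path_mul0 y : path_mul 0 y = 0.
Proof. by rewrite -[X in path_mul X](scale0r 0) -path_scaleAl scale0r. Qed.

Lemma path_mulr0 x : path_mul x 0 = 0.
Proof. by rewrite -[X in path_mul _ X](scale0r 0) -path_scaleAr scale0r. Qed.

Lemma path_ind (P : A -> Prop) :
    (forall x y, P x -> P y -> P (x + y)) ->
    (forall c x, P x -> P (c *: x)) ->
    (forall p, P (path_gen (src p) (tgt p))) -> P 0 ->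
  forall x, P x.
Proof.
move=> PD PZ Pg P0 x; rewrite (path_decomp x).
by apply: (big_ind P) => // p _; apply/PZ/Pg.
Qed.

Fact path_mulA : associative path_mul.
Proof.
move=> x y z; move: x; apply: path_ind => [x x' ex ex'|c x ex|p|].
- by rewrite !path_mulDl ex ex'.
- by rewrite -!path_scaleAl ex.
- move: y; apply: path_ind => [y y' ey ey'|c y ey|q|].
  + by rewrite path_mulDl !path_mulDr path_mulDl ey ey'.
  + by rewrite -path_scaleAr -!path_scaleAl -path_scaleAr ey.
  + move: z; apply: path_ind => [z z' ez ez'|c z ez|r|].
    * by rewrite !path_mulDr ez ez'.
    * by rewrite -!path_scaleAr ez.
    * have [[lp lq] lr] := (arrow_le p, arrow_le q, arrow_le r).
      have lqr : tgt q = src r -> (src q <= tgt r)%O.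
        by move=> e; apply: (le_trans lq); rewrite e.
      have lpq : tgt p = src q -> (src p <= tgt q)%O.
        by move=> e; apply: (le_trans lp); rewrite e.
      rewrite (path_gen_mul lq lr) (path_gen_mul lp lq).
      have [qr|/negPf qr] := eqVneq (tgt q) (src r);
        have [pq|/negPf pq] := eqVneq (tgt p) (src q).
      - rewrite (path_gen_mul lp (lqr qr)) (path_gen_mul (lpq pq) lr).
        by rewrite pq qr !eqxx.
      - by rewrite (path_gen_mul lp (lqr qr)) pq path_mul0.
      - by rewrite (path_gen_mul (lpq pq) lr) qr path_mulr0.
      - by rewrite path_mul0 path_mulr0.
    * by rewrite !path_mulr0.
  + by rewrite path_mul0 path_mulr0 path_mul0.
- by rewrite !path_mul0.
Qed.

Fact path_mul1 : left_id path_one path_mul.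
Proof.
apply: path_ind => [x x' ex ex'|c x ex|p|]; rewrite ?path_mulr0 //.
- by rewrite path_mulDr ex ex'.
- by rewrite -path_scaleAr ex.
rewrite (big_morph (path_mul^~ _) (fun u v => path_mulDl u v _) (path_mul0 _)).
have lp := arrow_le p; rewrite (bigD1 (src p)) //= big1 => [|a /negPf ap].
  by rewrite path_gen_mul // eqxx addr0.
by rewrite path_gen_mul // ap.
Qed.

Fact path_mulr1 : right_id path_one path_mul.
Proof.
apply: path_ind => [x x' ex ex'|c x ex|p|]; rewrite ?path_mul0 //.
- by rewrite path_mulDl ex ex'.
- by rewrite -path_scaleAl ex.
rewrite (big_morph (path_mul _) (path_mulDr _) (path_mulr0 _)).
have lp := arrow_le p; rewrite (bigD1 (tgt p)) //= big1 => [|a /negPf ap].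
  by rewrite path_gen_mul // eqxx addr0.
by rewrite path_gen_mul // eq_sym ap.
Qed.

Fact path_one_neq0 : path_one != 0.
Proof.
pose r : arrow L := exist _ (\bot, \bot)%O (lexx \bot%O).
apply/eqP => /ffunP/(_ r)/eqP; rewrite sum_ffunE (bigD1 \bot%O) //= big1.
  by rewrite !ffunE eqxx addr0 oner_eq0.
by move=> a /negPf a0; rewrite ffunE /= xpair_eqE eq_sym a0.
Qed.

HB.instance Definition _ := GRing.Zmodule_isNzRing.Build A
  path_mulA path_mul1 path_mulr1 path_mulDl path_mulDr path_one_neq0.
HB.instance Definition _ := GRing.Lmodule_isLalgebra.Build K A path_scaleAl.
HB.instance Definition _ := GRing.Lalgebra_isAlgebra.Build K A path_scaleAr.
HB.instance Definition _ := Algebra_isFalgebra.Build K A.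

Lemma path_mulE x y : x * y = path_mul x y. Proof. by []. Qed.

(* The linear extension of (a <= b) |-> (~` b <= ~` a). *)
Definition compl_fun x : A :=
  \sum_p x p *: path_gen (~` tgt p)%O (~` src p)%O.

Fact compl_fun_linear : linear compl_fun.
Proof.
move=> c x y; rewrite /compl_fun scaler_sumr -big_split; apply: eq_bigr => p _.
by rewrite /= !ffunE scalerDl scalerA.
Qed.

Definition compl_lfun : 'End(A) := linfun compl_fun.

Fact compl_lfunE x : compl_lfun x = compl_fun x.
Proof.
pose fL := GRing.isLinear.Build K A A _ compl_fun compl_fun_linear.
pose f : {linear A -> A} := HB.pack compl_fun fL.
exact: (lfunE f).
Qed.

Lemma compl_gen (a b : L) : (a <= b)%O ->
  compl_lfun (path_gen a b) = path_gen (~` b)%O (~` a)%O.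
Proof.
move=> ab; pose p : arrow L := exist _ (a, b) ab.
rewrite compl_lfunE -[path_gen a b]/(path_gen (src p) (tgt p)).
rewrite /compl_fun (bigD1 p) //= big1 => [|q /negPf qp].
  by rewrite path_genE eqxx scale1r addr0.
by rewrite path_genE qp scale0r.
Qed.

Fact compl_lfunK : involutive compl_lfun.
Proof.
apply: path_ind => [x y ex ey|c x ex|p|].
- by rewrite !linearD /= ex ey.
- by rewrite !linearZ /= ex.
- by have lp := arrow_le p; rewrite !compl_gen ?leC // !complK.
- by rewrite !linear0.
Qed.

Fact compl_lfun1 : compl_lfun 1 = 1.
Proof.
rewrite -[1]/path_one linear_sum /= (reindex_inj (@compl_inj _ L)) /=.
by apply: eq_bigr => a _; rewrite compl_gen // complK.
Qed.

Fact compl_lfunM x y : compl_lfun (x * y) = compl_lfun y * compl_lfun x.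
Proof.
move: x; apply: path_ind => [x x' ex ex'|c x ex|p|].
- by rewrite mulrDl !linearD /= ex ex' mulrDr.
- by rewrite -scalerAl !linearZ /= ex scalerAr.
- move: y; apply: path_ind => [y y' ey ey'|c y ey|q|].
  + by rewrite mulrDr !linearD /= ey ey' mulrDl.
  + by rewrite -scalerAr !linearZ /= ey scalerAl.
  + have [lp lq] := (arrow_le p, arrow_le q).
    rewrite [_ * _]path_gen_mul // !compl_gen // [RHS]path_gen_mul ?leC //.
    rewrite (inj_eq (@compl_inj _ L)) eq_sym.
    case: eqP => [pq|_]; last exact: linear0.
    by rewrite compl_gen //; apply: le_trans lp _; rewrite -pq.
  + by rewrite mulr0 linear0 mul0r.
- by rewrite mul0r linear0 mulr0.
Qed.

Definition complementation : anti_automorphism A :=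
  AntiAut (inv_bij compl_lfunK) compl_lfun1 compl_lfunM.

End PathAlgebra.

(* Main.v *)
Require Import Defs.
From HB Require Import structures.
From mathcomp Require Import all_boot all_order all_algebra all_field.

Set Implicit Arguments.
Unset Strict Implicit.
Unset Printing Implicit Defensive.

Import Order.Theory GRing.Theory.

(** The twisted dual [D M = (M_phi)^*] is [Hom(M, K)] with [a] acting through
    [phi a].  Since [phi] is an involution, a homomorphism [M -> D N] is a
    bilinear form on [M * N] for which [a] acting on one side is [phi a] acting
    on the other, a symmetric condition; so [Hom(M, D N)] and [Hom(N, D M)] are
    exchanged by flipping the two arguments ([flip]).  Flipping the identity
    of [D M] gives evaluation [M -> D (D M)], which is bijective in finite
    dimension, so [D] is its own quasi-inverse ([twisted_dual_equivalence]).
    Flipping also turns a lifting problem for [M] into an extension problem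
    for [D M], and [D] exchanges injections with surjections; hence [M] is
    projective exactly when [D M] is injective ([projective_dual]).

    For QF-2, write [e_a] for the vertex idempotent at [a] and [(a -> b)] for
    the basis vector of [a <= b].  In a nonzero projective right module [P],
    choose [a] minimal with [P e_a <> 0] and a nonzero [v] in [P e_a].  No
    nonzero element of [P e_a] is reached by a strict arrow [b -> a], so a
    linear form equal to [1] at [v] defines a homomorphism from [P] to the simple module at
    [a], and lifting it along [A -> S_a] gives [h : P -> e_a A] that maps [v]
    to [e_a]: [v A] is a direct summand isomorphic to [e_a A].  If [P] is
    indecomposable then [h] is injective.  A nonzero element of [e_a A] has a
    nonzero coefficient at some [(a -> b)], and multiplying it by
    [(b -> top)] gives a nonzero multiple of [(a -> top)]; thus every nonzero
    submodule contains the line of [v (a -> top)], which is therefore the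
    socle ([indecomposable_projective_simple_socle]).  Left modules become
    right modules through [phi], with the same submodules.

    For the last claim, the simple module at [top] is [e_top A], hence
    projective.  It embeds in [A] as the line of [(bot -> top)], which equals
    [e_bot (bot -> top)]; a retraction would send [e_bot] into
    [S_top e_bot], which is zero when [bot <> top].  So [A] is
    quasi-Frobenius only if [bot = top]; in that case [A = K] and every module
    is both projective and injective. *)

(** * Linear forms *)

Section LinearForms.
Local Open Scope ring_scope.
Variables (K : fieldType).
Implicit Types U V : vectType K.

(** Vector space homomorphisms are matrices here, so a linear function has to be
    converted into one; [lfun_ofE] is the only property of the conversion. *)
Definition lfun_of U V (f : U -> V) (f_lin : linear f) : 'Hom(U, V) :=
  linfun (HB.pack_for {linear U -> V} f
            (GRing.isLinear.Build K U V _ f f_lin)).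

Lemma lfun_ofE U V (f : U -> V) (f_lin : linear f) : lfun_of f_lin =1 f.
Proof. by move=> u; rewrite /lfun_of lfunE. Qed.

Variable V : vectType K.
Local Notation e := (vbasis (fullv : {vspace V})).
Implicit Types (v : V) (xi : 'Hom(V, K^o)).

Fact coord_linear i : linear (fun v => coord e i v : K^o).
Proof. by move=> c u v; rewrite linearP. Qed.

Definition coord_form i : 'Hom(V, K^o) := lfun_of (coord_linear i).

Lemma coord_formE i v : coord_form i v = coord e i v.
Proof. exact: lfun_ofE. Qed.

Lemma coord_form_decomp v : v = \sum_i coord_form i v *: e`_i.
Proof.
rewrite [LHS](coord_vbasis (memvf v)).
by apply: eq_bigr => i _; rewrite coord_formE.
Qed.

Lemma form_eq1 v : v != 0 -> exists xi, xi v = 1.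
Proof.
move=> v0; have [i vi0|no_i] := pickP (fun i => coord_form i v != 0).
  exists ((coord_form i v)^-1 *: coord_form i).
  by rewrite scale_lfunE [LHS]mulVf.
case/eqP: v0; rewrite (coord_form_decomp v) big1 // => i _.
by move/negbFE/eqP: (no_i i) => ->; rewrite scale0r.
Qed.

Lemma forms_separate u v : (forall xi, xi u = xi v) -> u = v.
Proof.
move=> uv; apply/eqP; rewrite -subr_eq0; apply/negPn/negP => /form_eq1[xi].
by rewrite linearB /= uv subrr => /esym/eqP; rewrite oner_eq0.
Qed.

(** The inverse of evaluation [V -> V^**], as an explicit formula in a basis
    and its dual basis: it avoids a dimension count. *)
Definition bidual_inv (psi : 'Hom('Hom(V, K^o), K^o)) : V :=
  \sum_i psi (coord_form i) *: e`_i.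

Lemma bidual_invE psi xi : xi (bidual_inv psi) = psi xi.
Proof.
have {2}->: xi = \sum_(i < \dim (fullv : {vspace V})) xi e`_i *: coord_form i.
  apply/lfunP => v; rewrite {1}(coord_form_decomp v) sum_lfunE linear_sum.
  by apply: eq_bigr => i _; rewrite linearZ scale_lfunE [LHS]mulrC.
rewrite /bidual_inv !linear_sum; apply: eq_bigr => i _.
by rewrite !linearZ [LHS]mulrC.
Qed.

Fact bidual_inv_linear : linear bidual_inv.
Proof.
move=> c psi chi; apply: forms_separate => xi.
by rewrite linearP /= !bidual_invE add_lfunE scale_lfunE.
Qed.

End LinearForms.

Section Modules.
Local Open Scope ring_scope.
Variables (K : fieldType) (A : falgType K) (s : side).
Implicit Types M N : fdmod A s.

Lemma actD M a b m : act M (a + b) m = act M a m + act M b m.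
Proof. by rewrite -[a]scale1r act_linear !scale1r add_lfunE. Qed.

Lemma act0 M m : act M 0 m = 0.
Proof. by apply: (addIr (act M 0 m)); rewrite -actD !add0r. Qed.

Lemma actZ M c a m : act M (c *: a) m = c *: act M a m.
Proof.
by rewrite -[c *: a]addr0 act_linear add_lfunE scale_lfunE act0 addr0.
Qed.

Lemma act_sum M (I : finType) (F : I -> A) m :
  act M (\sum_i F i) m = \sum_i act M (F i) m.
Proof.
exact: (big_morph (fun a => act M a m) (fun a b => actD a b m) (act0 m)).
Qed.

Section FdhomOf.
Variables (M N : fdmod A s) (f : M -> N) (f_lin : linear f).
Hypothesis f_act : forall a m, f (act M a m) = act N a (f m).

Fact fdhom_of_act a m :
  lfun_of f_lin (act M a m) = act N a (lfun_of f_lin m).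
Proof. by rewrite !lfun_ofE. Qed.

Definition fdhom_of : fdhom M N := FdHom fdhom_of_act.

Lemma fdhom_ofE : fdhom_of =1 f.
Proof. exact: lfun_ofE. Qed.

End FdhomOf.

Lemma fdhomP M N (f g : fdhom M N) : f =1 g -> f = g.
Proof. by move=> fg; apply: fdhom_inj; apply/lfunP. Qed.

Lemma fdhom_compE M N (P : fdmod A s) (g : fdhom N P) (f : fdhom M N) m :
  fdhom_comp g f m = g (f m).
Proof. exact: comp_lfunE. Qed.

(** This retraction and the section below are only linear: they serve to extend
    linear forms, and they are homomorphisms if the algebra acts by scalars. *)
Lemma inj_hom_retract M N (g : fdhom M N) :
  injective g -> exists r : 'Hom(N, M), cancel g r.
Proof.
move=> g_inj; exists (g^-1)%VF; apply: lker0_lfunK; exact/lker0P.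
Qed.

Lemma surj_hom_section M N (g : fdhom M N) :
  (forall n, exists m, g m = n) -> exists r : 'Hom(N, M), cancel r g.
Proof.
move=> g_surj; exists (g^-1)%VF => n; have [m <-] := g_surj n.
by apply: limg_lfunVK; apply: memv_img; apply: memvf.
Qed.

(** A line that lies in every nonzero submodule is the only simple submodule. *)
Lemma simple_socle_line M (v : M) :
    v != 0 -> submodule <[v]>%VS ->
    (forall U, submodule U -> U <> 0%VS -> v \in U) ->
  has_simple_socle M.
Proof.
move=> v0 subv v_min; have line0 : <[v]>%VS <> 0%VS.
  by move=> e0; move: v0; rewrite -memv0 -e0 memv_line.
have simple_v : simple_submodule <[v]>%VS.
  split=> // U subU Uv; have [->|/eqP U0] := eqVneq U 0%VS; first by left.
  right; apply/eqP; rewrite eqEsubv Uv -memvE; exact: v_min.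
have line_eq S : simple_submodule S -> S = <[v]>%VS.
  case=> subS S0 minS; have := minS _ subv; rewrite -memvE.
  by case=> //; exact: v_min.
exists <[v]>%VS; split=> // m; split=> [mv|[n [S [simpS]]]].
  by exists 1%N, (fun=> <[v]>%VS); split=> //; rewrite big_ord1.
by apply: subvP m; apply/subv_sumP => i _; rewrite (line_eq _ (simpS i)).
Qed.

End Modules.

(** * The twisted dual *)

Section Duality.
Local Open Scope ring_scope.
Variables (K : fieldType) (A : falgType K) (phi : anti_automorphism A).
Hypothesis phiK : involutive phi.
Local Notation D := (twisted_dual phi).
Local Notation rmod := (fdmod A RightSide).
Implicit Types M N : rmod.

Lemma twisted_dual_actE M a (xi : D M) (m : M) :
  (act (D M) a xi : 'Hom(M, K^o)) m = (xi : 'Hom(M, K^o)) (act M (phi a) m).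
Proof.
by rewrite -[act _ _ _]/(@dual_act K A (twist phi M) a xi) dual_actE comp_lfunE.
Qed.

Lemma twisted_dual_homE M N (f : fdhom M N) (xi : D N) (m : M) :
  ((fmor D f : fdhom (D N) (D M)) xi : 'Hom(M, K^o)) m
    = (xi : 'Hom(N, K^o)) (f m).
Proof.
rewrite -[fun_of_lfun _ xi]/(dual_hom_lfun (twist_hom phi f) xi).
by rewrite dual_hom_lfunE comp_lfunE.
Qed.

(** Read as a bilinear form on [M * N], the homomorphism [f] satisfies
    [f (m a) n = f m (n phi(a))]; with [phi] involutive, this condition is
    symmetric in its two arguments, so the flipped form is again one. *)
Section Flip.
Variables (M N : rmod) (f : fdhom M (D N)).

Fact flip_form_linear (n : N) : linear (fun m => (f m : 'Hom(N, K^o)) n).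
Proof. by move=> c x y; rewrite linearP add_lfunE scale_lfunE. Qed.

Definition flip_form (n : N) : D M := lfun_of (flip_form_linear n).

Lemma flip_formE n m : (flip_form n : 'Hom(M, K^o)) m = (f m : 'Hom(N, K^o)) n.
Proof. exact: lfun_ofE. Qed.

Fact flip_linear : linear flip_form.
Proof.
move=> c x y; apply/lfunP => m; rewrite add_lfunE scale_lfunE !flip_formE.
by rewrite linearP.
Qed.

Fact flip_act a n : flip_form (act N a n) = act (D M) a (flip_form n).
Proof.
apply/lfunP => m; rewrite twisted_dual_actE !flip_formE hom_act.
by rewrite twisted_dual_actE phiK.
Qed.

Definition flip : fdhom N (D M) := fdhom_of flip_linear flip_act.

Lemma flipE n m : (flip n : 'Hom(M, K^o)) m = (f m : 'Hom(N, K^o)) n.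
Proof. by rewrite fdhom_ofE flip_formE. Qed.

End Flip.

(** Flipping [id : D M -> D M] yields evaluation, so its compatibility with the
    action needs no separate proof. *)
Definition bidual_eval M : fdhom M (D (D M)) := flip (fdhom_id (D M)).

Lemma bidual_evalE M (m : M) (xi : D M) :
  (bidual_eval M m : 'Hom(D M, K^o)) xi = (xi : 'Hom(M, K^o)) m.
Proof. by rewrite flipE /= id_lfunE. Qed.

Lemma bidual_invK M (psi : D (D M)) : bidual_eval M (bidual_inv psi) = psi.
Proof. by apply/lfunP => xi; rewrite bidual_evalE bidual_invE. Qed.

Lemma bidual_evalK M : cancel (bidual_eval M) (@bidual_inv K M).
Proof.
move=> m; apply: forms_separate => xi.
by rewrite bidual_invE bidual_evalE.
Qed.

Lemma bidual_eval_inj M (m n : M) : bidual_eval M m = bidual_eval M n -> m = n.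
Proof. exact: (can_inj (@bidual_evalK M)). Qed.

Fact bidual_inv_act M a (psi : D (D M)) :
  bidual_inv (act (D (D M)) a psi) = act M a (bidual_inv psi).
Proof.
by apply: bidual_eval_inj; rewrite hom_act !bidual_invK.
Qed.

Definition bidual_inv_hom M : fdhom (D (D M)) M :=
  @fdhom_of _ _ _ (D (D M)) M _ (@bidual_inv_linear K M) (@bidual_inv_act M).

Lemma bidual_inv_homE M psi : bidual_inv_hom M psi = bidual_inv psi.
Proof. exact: fdhom_ofE. Qed.

(** Naturality of evaluation. *)
Lemma bidual_evalN M N (f : fdhom M N) m :
  bidual_eval N (f m) =
    (fmor D (fmor D f) : fdhom (D (D M)) (D (D N))) (bidual_eval M m).
Proof.
by apply/lfunP => xi; rewrite twisted_dual_homE !bidual_evalE twisted_dual_homE.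
Qed.

(** The quasi-inverse of [D]. *)
Definition twisted_dual_op :
    functor (mod_category A RightSide) (opposite (mod_category A RightSide)) :=
  @Functor (mod_category A RightSide) (opposite (mod_category A RightSide))
    D (fun M N f => fmor D f) (fun M => fmor1 D M)
    (fun M N P g f => @fmorM _ _ D P N M f g).

Theorem twisted_dual_equivalence : equivalence D.
Proof.
have evK M : fdhom_comp (bidual_eval M) (bidual_inv_hom M) = fdhom_id _.
  apply: fdhomP => psi.
  by rewrite fdhom_compE bidual_inv_homE bidual_invK id_lfunE.
have invK M : fdhom_comp (bidual_inv_hom M) (bidual_eval M) = fdhom_id _.
  apply: fdhomP => m.
  by rewrite fdhom_compE bidual_inv_homE bidual_evalK id_lfunE.
exists twisted_dual_op; split.
  exists (fun M => bidual_eval M); split=> [M N f|M].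
    apply: (@fdhomP _ _ RightSide) => m; rewrite /= !comp_lfunE.
    exact: bidual_evalN.
  by exists (bidual_inv_hom M); [exact: evK | exact: invK].
exists bidual_inv_hom; split=> [M N f|M].
  apply: (@fdhomP _ _ RightSide) => psi; rewrite /= !comp_lfunE.
  apply: bidual_eval_inj; rewrite bidual_evalN !bidual_inv_homE.
  by rewrite !bidual_invK.
by exists (bidual_eval M); [exact: evK | exact: invK].
Qed.

(** To extend [f : X -> D M] along [g : X -> Y], lift its flip [M -> D X]
    through the surjection [D g] and flip the lift back.  Conversely, to lift
    [f : M -> Y] through [g : X -> Y], extend [D f] along the injection [D g];
    the flip of the extension is a map [M -> D (D X)], and [D (D X)] is [X]. *)
Theorem projective_dual M : projective M <-> injective_mod (D M).
Proof.
split=> [projM X Y g f g_inj | injDM X Y g f g_surj].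
  have [|h hP] := projM _ _ (fmor D g : fdhom (D Y) (D X)) (flip f).
    move=> xi; have [r rK] := inj_hom_retract g_inj.
    exists ((xi : 'Hom(X, K^o)) \o r)%VF.
    by apply/lfunP => x; rewrite twisted_dual_homE comp_lfunE rK.
  exists (flip h) => x; apply/lfunP => m.
  by rewrite flipE -twisted_dual_homE hP flipE.
have [|h hP] := injDM _ _ (fmor D g : fdhom (D Y) (D X)) (fmor D f).
  move=> xi eta /lfunP e; apply/lfunP => y; have [x <-] := g_surj y.
  by have := e x; rewrite !twisted_dual_homE.
exists (fdhom_comp (bidual_inv_hom X) (flip h)) => m.
apply: forms_separate => eta.
rewrite fdhom_compE bidual_inv_homE -twisted_dual_homE bidual_invE (flipE h) hP.
by rewrite twisted_dual_homE.
Qed.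

(** Restriction along [phi] makes a right module of a left module on the same
    vector space, with the same submodules; statements about left modules thus
    reduce to right ones. *)
Section Untwist.
Variable N : fdmod A LeftSide.

Definition untwist_act (a : A) : 'End(N) := act N (phi a).

Fact untwist_act_linear : linear untwist_act.
Proof. by move=> c a b; rewrite /untwist_act linearP act_linear. Qed.

Fact untwist_act1 m : untwist_act 1 m = m.
Proof. by rewrite /untwist_act anti1 act1. Qed.

Fact untwist_actM a b m :
  untwist_act (a * b) m = untwist_act b (untwist_act a m).
Proof. by rewrite /untwist_act antiM actM. Qed.

Definition untwist : rmod :=
  FdMod RightSide untwist_act_linear untwist_act1 untwist_actM.

Lemma untwist_submodule (U : {vspace N}) :
  @submodule _ _ _ untwist U <-> submodule U.
Proof.
split=> subU a m mU; last exact: subU.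
by rewrite -[a]phiK; apply: (subU (phi a)).
Qed.

Lemma untwist_projective : projective N -> projective untwist.
Proof.
move=> projN X Y g f g_surj.
have f_act a m : f (act N a m) = act (twist phi Y) a (f m).
  by rewrite -[a in LHS]phiK; apply: (@hom_act _ _ _ untwist Y f).
have [h hP] := projN _ _ (twist_hom phi g)
                 (@FdHom _ _ _ N (twist phi Y) f f_act) g_surj.
have h_act a m : h (act untwist a m) = act X a (h m).
  by rewrite [LHS]hom_act /= /twist_act phiK.
by exists (@FdHom _ _ _ untwist X h h_act).
Qed.

Lemma untwist_indecomposable : indecomposable N -> indecomposable untwist.
Proof.
case=> N0 indN; split=> // U V /untwist_submodule sU /untwist_submodule sV.
exact: indN.
Qed.

Lemma untwist_simple (U : {vspace N}) :
  @simple_submodule _ _ _ untwist U <-> simple_submodule U.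
Proof.
split=> -[/untwist_submodule subU U0 minU]; split=> // V /untwist_submodule.
  exact: minU.
exact: minU.
Qed.

Lemma untwist_simple_socle : has_simple_socle untwist -> has_simple_socle N.
Proof.
case=> S [socS simpS]; exists S; split; last exact/untwist_simple.
move=> m; split=> [/socS|] [n [T [simpT mT]]].
  by exists n, T; split=> // i; apply/untwist_simple.
by apply/socS; exists n, T; split=> // i; apply/untwist_simple.
Qed.

End Untwist.

End Duality.

(** * Modules over the path algebra *)

Section PathModules.
Local Open Scope ring_scope.
Variables (K : fieldType) (d : Order.disp_t) (L : finCTBDistrLatticeType d).
Local Notation A := (path_algebra K L).
Local Notation gen := (@path_gen K d L).
Local Notation rmod := (fdmod A RightSide).
Implicit Types (a b c : L) (p q : arrow L) (x y : A) (M P : rmod).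

Lemma path_gen_mulE a b c e : (a <= b)%O -> (c <= e)%O ->
  gen a b * gen c e = if b == c then gen a e else 0.
Proof. exact: path_gen_mul. Qed.

Definition loop a : arrow L := exist _ (a, a) (lexx a).

(** The character of [A] by which it acts on the simple module at [a]. *)
Definition loop_coef a x : K := x (loop a).

Fact loop_coef_linear a : linear (loop_coef a : A -> K^o).
Proof. by move=> c x y; rewrite /loop_coef !ffunE. Qed.

Lemma loop_coef_gen a b c :
  loop_coef a (gen b c) = ((a == b) && (a == c))%:R.
Proof. by rewrite /loop_coef ffunE xpair_eqE. Qed.

Lemma loop_coef1 a : loop_coef a 1 = 1.
Proof.
rewrite /loop_coef sum_ffunE (bigD1 a) //= big1 => [|b ba].
  by rewrite addr0 -/(loop_coef a _) loop_coef_gen eqxx.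
by rewrite -/(loop_coef a _) loop_coef_gen eq_sym (negPf ba).
Qed.

(** A product of two arrows is the loop at [a] only if both factors are that
    loop, by antisymmetry of the order. *)
Lemma loop_coefM a x y : loop_coef a (x * y) = loop_coef a x * loop_coef a y.
Proof.
have cD u v : loop_coef a (u + v) = loop_coef a u + loop_coef a v.
  by rewrite /loop_coef ffunE.
have cZ k u : loop_coef a (k *: u) = k * loop_coef a u.
  by rewrite /loop_coef ffunE.
have c0 : loop_coef a 0 = 0 by rewrite /loop_coef ffunE.
move: x; apply: path_ind => [x x' ex ex'|k x ex|p|]; last 1 first.
- by rewrite mul0r c0 mul0r.
- by rewrite mulrDl !cD ex ex' mulrDl.
- by rewrite -scalerAl !cZ ex mulrA.
move: y; apply: path_ind => [y y' ey ey'|k y ey|q|]; last 1 first.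
- by rewrite mulr0 c0 mulr0.
- by rewrite mulrDr !cD ey ey' mulrDr.
- by rewrite -scalerAr !cZ ey mulrCA.
have [lp lq] := (arrow_le p, arrow_le q).
rewrite path_gen_mulE // !loop_coef_gen -natrM mulnb.
have [pq|pq] := eqVneq (tgt p) (src q).
  rewrite loop_coef_gen pq; congr (nat_of_bool _)%:R.
  have [ap|//] := eqVneq a (src p); have [aq|_] := eqVneq a (tgt q).
    rewrite !andbT /= andbb; apply/esym/eqP/le_anti.
    by rewrite {1}ap -pq lp pq aq.
  by rewrite !andbF.
rewrite c0; have [ap|] := eqVneq a (tgt p); last by rewrite andbF.
by rewrite ap (negPf pq) andbF.
Qed.

(** Each Peirce corner [e_a A e_b] is the line of the arrow [a -> b]. *)
Lemma path_corner p x :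
  gen (src p) (src p) * x * gen (tgt p) (tgt p) = x p *: gen (src p) (tgt p).
Proof.
move: x; apply: path_ind => [x y ex ey|k x ex|q|].
- by rewrite mulrDr mulrDl ex ey ffunE scalerDl.
- by rewrite -scalerAr -scalerAl ex ffunE scalerA.
- have lq := arrow_le q; rewrite path_genE path_gen_mulE //.
  have [->|pq] := eqVneq p q.
    by rewrite eqxx path_gen_mulE // eqxx scale1r.
  rewrite scale0r; have [s_eq|_] := eqVneq (src p) (src q); last exact: mul0r.
  rewrite s_eq path_gen_mulE //.
  have [t_eq|//] := eqVneq (tgt q) (tgt p); case/eqP: pq; apply: val_inj.
  by rewrite [LHS]surjective_pairing [RHS]surjective_pairing; congr pair.
- by rewrite mulr0 mul0r ffunE scale0r.
Qed.

(** The only arrow out of the maximum is its loop, so [A] acts on arrows ending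
    there through a character. *)
Lemma path_gen_top_mul a x :
  gen a \top%O * x = loop_coef \top%O x *: gen a \top%O.
Proof.
move: x; apply: path_ind => [x y ex ey|k x ex|q|].
- by rewrite mulrDr ex ey /loop_coef ffunE scalerDl.
- by rewrite -scalerAr ex /loop_coef ffunE scalerA.
- rewrite path_gen_mulE ?lex1 ?arrow_le // loop_coef_gen.
  have [q1|] := eqVneq \top%O (src q); last by rewrite scale0r.
  have: (\top <= tgt q)%O by rewrite q1 arrow_le.
  by rewrite le1x => /eqP ->; rewrite eqxx scale1r.
- by rewrite mulr0 /loop_coef ffunE scale0r.
Qed.

Lemma ractM M x y m : act M (x * y) m = act M y (act M x m).
Proof. exact: actM. Qed.

Lemma act_genM M a b c e m : (a <= b)%O -> (c <= e)%O ->
  act M (gen c e) (act M (gen a b) m) =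
    if b == c then act M (gen a e) m else 0.
Proof.
move=> ab ce; rewrite -ractM path_gen_mulE //.
by case: eqP => // _; exact: act0.
Qed.

(** Among the vertices that act on [M] nontrivially, choose one with the fewest
    elements below it. *)
Lemma minimal_vertex M (m : M) : m != 0 ->
  exists a (v : M), [/\ v != 0, act M (gen a a) v = v &
    forall b w, (b < a)%O -> act M (gen b b) w = 0].
Proof.
move=> m0; have [a0 Pa0] : exists a, act M (gen a a) != 0.
  case: (pickP (fun a => act M (gen a a) != 0)) => [a|none]; first by exists a.
  case/eqP: m0; rewrite -[m](@act1 _ _ _ M) [1]/(path_one K L) act_sum big1 //.
  by move=> a _; move/negbFE/eqP: (none a) => ->; rewrite zero_lfunE.
case: (@arg_minnP _ a0 (fun a => act M (gen a a) != 0)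
         (fun a => #|[pred c | (c <= a)%O]|) Pa0) => a Pa a_min.
have /lfunPn[u] := Pa; rewrite zero_lfunE => u0.
exists a, (act M (gen a a) u); split=> // [|b w ba].
  by rewrite act_genM // eqxx.
have [->|Pb] := eqVneq (act M (gen b b)) 0; first exact: zero_lfunE.
have := a_min b Pb; rewrite leqNgt proper_card //; apply/properP; split.
  by apply/subsetP => c; rewrite !inE => /le_trans; apply; exact: ltW.
by exists a; rewrite !inE ?lexx // lt_geF.
Qed.

(** If the vertices below [a] act by zero then so does every strict arrow into
    [a], since it factors through its source. Hence [m |-> m e_a], followed by
    any linear form, is a homomorphism to the simple module at [a]. *)
Lemma minimal_vertex_act M a :
    (forall b w, (b < a)%O -> act M (gen b b) w = 0) ->
  forall x m, act M (gen a a) (act M x m)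
                = loop_coef a x *: act M (gen a a) m.
Proof.
move=> below x m; move: x; apply: path_ind => [x y ex ey|k x ex|q|].
- by rewrite actD linearD /= ex ey /loop_coef ffunE scalerDl.
- by rewrite actZ linearZ /= ex /loop_coef ffunE scalerA.
- have lq := arrow_le q; rewrite act_genM // loop_coef_gen.
  have [qa|_] := eqVneq (tgt q) a; last by rewrite andbF scale0r.
  rewrite -qa andbT; have [->|sq] := eqVneq (tgt q) (src q).
    by rewrite scale1r.
  have := @act_genM M (src q) (src q) (src q) (tgt q) m (lexx _) lq.
  rewrite eqxx => <-; rewrite below ?linear0 ?scale0r // -qa.
  by rewrite lt_neqAle eq_sym sq.
- by rewrite act0 linear0 /loop_coef ffunE scale0r.
Qed.

Section Simple.
Variable a : L.

Definition simple_act x : 'End(K^o) := loop_coef a x *: \1%VF.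

Lemma simple_actE x (k : K^o) : simple_act x k = loop_coef a x * k.
Proof. by rewrite scale_lfunE id_lfunE. Qed.

Fact simple_act_linear : linear simple_act.
Proof.
by move=> c x y; rewrite /simple_act loop_coef_linear scalerDl scalerA.
Qed.

Fact simple_act1 k : simple_act 1 k = k.
Proof. by rewrite simple_actE loop_coef1 mul1r. Qed.

Fact simple_actM x y k : simple_act (x * y) k = simple_act y (simple_act x k).
Proof. by rewrite !simple_actE loop_coefM mulrCA mulrA. Qed.

Definition simple_mod : rmod :=
  FdMod RightSide simple_act_linear simple_act1 simple_actM.

End Simple.

Fact regular_act_linear : linear (@amulr K A).
Proof. exact: linearP. Qed.

Fact regular_act1 x : amulr 1 x = x.
Proof. by rewrite lfunE /= mulr1. Qed.

Fact regular_actM x y z : amulr (x * y) z = amulr y (amulr x z).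
Proof. by rewrite !lfunE /= mulrA. Qed.

Definition regular : rmod :=
  FdMod RightSide regular_act_linear regular_act1 regular_actM.

Lemma regular_actE x y : act regular x y = y * x.
Proof. by rewrite lfunE. Qed.

Fact loop_coef_act a x (y : regular) :
  loop_coef a (act regular x y) = act (simple_mod a) x (loop_coef a y : K^o).
Proof. by rewrite regular_actE simple_actE loop_coefM mulrC. Qed.

Definition loop_coef_hom a : fdhom regular (simple_mod a) :=
  @fdhom_of _ _ _ regular (simple_mod a) _
    (@loop_coef_linear a) (@loop_coef_act a).

(** The homomorphism from [P] to the simple module at [a] given by a form equal
    to [1] at [v] lifts to the regular module.  After left multiplication by
    [e_a], the lift sends [v = v e_a] into the corner [e_a A e_a = K e_a], and
    the coefficient there is [1]. *)
Lemma projective_splits P a (v : P) :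
    projective P -> v != 0 -> act P (gen a a) v = v ->
    (forall b w, (b < a)%O -> act P (gen b b) w = 0) ->
  exists h : fdhom P regular,
    h v = gen a a /\ forall m, gen a a * h m = h m.
Proof.
move=> projP v0 av below; have [lam lamv] := form_eq1 v0.
pose pi m : K^o := lam (act P (gen a a) m).
have pi_lin : linear pi by move=> k m n; rewrite /pi !linearP.
have pi_act x m : pi (act P x m) = act (simple_mod a) x (pi m).
  by rewrite /pi minimal_vertex_act // linearZ simple_actE.
pose f := @fdhom_of _ _ _ P (simple_mod a) _ pi_lin pi_act.
have [k|h hP] := projP _ _ (loop_coef_hom a) f.
  exists (k *: gen a a : A); rewrite fdhom_ofE /loop_coef ffunE.
  by rewrite -/(loop_coef a _) loop_coef_gen eqxx [LHS]mulr1.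
pose g m : A := gen a a * h m.
have g_lin : linear g by move=> k m n; rewrite /g linearP mulrDr -scalerAr.
have g_act x m : g (act P x m) = act regular x (g m).
  by rewrite /g hom_act !regular_actE mulrA.
exists (@fdhom_of _ _ _ P regular _ g_lin g_act); split=> [|m].
  rewrite fdhom_ofE /g -[in LHS]av hom_act regular_actE mulrA.
  have := path_corner (loop a) (h v); rewrite /src /tgt /= => ->.
  have := hP v; rewrite !fdhom_ofE /pi av lamv /loop_coef => ->.
  exact: scale1r.
by rewrite fdhom_ofE /g mulrA path_gen_mulE // eqxx.
Qed.

(** With [h] as in [projective_splits], the orbit map [x |-> v x] satisfies
    [h (v x) = e_a x], so [P] is the direct sum of [v A] and the kernel of [h];
    the first summand contains [v], so the second one vanishes. *)
Lemma indecomposable_projective_embeds P :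
    projective P -> indecomposable P ->
  exists a (v : P) (h : fdhom P regular),
    [/\ h v = gen a a, act P (gen a a) v = v,
        (forall m, gen a a * h m = h m) & injective h].
Proof.
move=> projP [P0 indP].
have [m0 m0_neq0] : exists m : P, m != 0.
  exists (vpick fullv); rewrite vpick0; exact/eqP.
have [a [v [v0 av below]]] := minimal_vertex m0_neq0.
have [h [hv ah]] := projective_splits projP v0 av below.
exists a, v, h; split=> //; apply/lker0P/eqP.
pose orb x : P := act P x v.
have orb_lin : linear orb by move=> k x y; rewrite /orb actD actZ.
pose F := lfun_of orb_lin.
have h_orb x : h (orb x) = gen a a * x by rewrite hom_act regular_actE hv.
have subF : submodule (limg F).
  move=> x _ /memv_imgP[y _ ->]; rewrite lfun_ofE -ractM.
  by rewrite -[act _ _ _]/(orb _) -(lfun_ofE orb_lin) memv_img ?memvf.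
have subker : submodule (lker h).
  move=> x m; rewrite !memv_ker => /eqP hm.
  by rewrite hom_act hm linear0.
have [||F0|//] := indP _ _ subF subker.
- apply/eqP; rewrite eqEsubv subvf; apply/subvP => m _.
  rewrite -[m](subrK (orb (h m))) addrC; apply: memv_add.
    by rewrite -(lfun_ofE orb_lin) memv_img ?memvf.
  by rewrite memv_ker linearB /= h_orb ah subrr.
- apply/eqP; rewrite -subv0; apply/subvP => m.
  rewrite memv_cap memv_ker => /andP[/memv_imgP[x _ ->]].
  rewrite lfun_ofE h_orb.
  move=> /eqP ax; rewrite memv0; apply/eqP.
  by rewrite /orb -[in LHS]av -ractM ax act0.
- case/eqP: v0; apply/eqP; rewrite -memv0 -F0 -av.
  by rewrite -[act _ _ _]/(orb _) -(lfun_ofE orb_lin) memv_img ?memvf.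
Qed.

(** The socle is the line of [w = v (a -> top)].  For [u] in a nonzero submodule
    [U], a nonzero coefficient [c] of [h u] at [(a -> b)] gives
    [h (u (b -> top)) = c (a -> top) = c (h w)], whence [w] is in [U]. *)
Lemma indecomposable_projective_simple_socle P :
  projective P -> indecomposable P -> has_simple_socle P.
Proof.
move=> projP indP.
have [a [v [h [hv av ah h_inj]]]] :=
  indecomposable_projective_embeds projP indP.
pose w := act P (gen a \top%O) v.
have hw : h w = gen a \top%O.
  by rewrite hom_act regular_actE hv path_gen_mulE ?lex1 // eqxx.
apply: (@simple_socle_line _ _ _ _ w).
- apply/eqP => w0; move: hw; rewrite w0 linear0 => /ffunP.
  move/(_ (exist _ (a, \top%O) (lex1 a))); rewrite !ffunE eqxx.
  by move/esym/eqP; rewrite oner_eq0.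
- move=> x _ /vlineP[k ->]; rewrite linearZ /= /w -ractM path_gen_top_mul actZ.
  by apply/memvZ/memvZ/memv_line.
move=> U subU /eqP U0; pose u := vpick U.
have hu0 : h u != 0.
  by rewrite -(linear0 h) (inj_eq h_inj) vpick0.
have [p hp] : exists p, (h u : A) p != 0.
  case: (pickP (fun p => (h u : A) p != 0)) => [p|none]; first by exists p.
  by case/eqP: hu0; apply/ffunP => p; rewrite ffunE; apply/eqP/negbFE/none.
have sp : src p = a.
  apply/eqP/negPn/negP => /negPf spa; case/eqP: hp.
  have := path_corner p (h u); rewrite -ah mulrA path_gen_mulE // spa.
  rewrite !mul0r => /ffunP/(_ p); rewrite [RHS]ffunE path_genE eqxx.
  by rewrite [RHS]mulr1 ah ffunE => <-.
have lp := arrow_le p.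
suff <- : ((h u : A) p)^-1 *: act P (gen (tgt p) \top%O) u = w.
  by apply/memvZ/subU/memv_pick.
have hu_tgt : h u * gen (tgt p) (tgt p) = (h u : A) p *: gen (src p) (tgt p).
  by rewrite -path_corner sp ah.
have hu_top : h u * gen (tgt p) \top%O = (h u : A) p *: gen a \top%O.
  have -> : gen (tgt p) \top%O = gen (tgt p) (tgt p) * gen (tgt p) \top%O.
    by rewrite path_gen_mulE ?lex1 // eqxx.
  by rewrite mulrA hu_tgt -scalerAl path_gen_mulE ?lex1 // eqxx sp.
apply: h_inj; rewrite hw linearZ /=.
have -> : h (act P (gen (tgt p) \top%O) u) = (h u : A) p *: gen a \top%O.
  by rewrite hom_act regular_actE.
by rewrite scalerA mulVf ?scale1r.
Qed.

Theorem path_algebra_QF2 : QF2 A.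
Proof.
split=> [P projP indP|P projP indP].
  exact: indecomposable_projective_simple_socle.
have phiK : involutive (complementation K L) := @compl_lfunK K d L.
apply: (untwist_simple_socle phiK).
apply: indecomposable_projective_simple_socle.
  exact: untwist_projective.
exact: untwist_indecomposable.
Qed.

(** This module is [e_top A]: a homomorphism from it into [M] amounts to an
    element of [M e_top]. *)
Lemma simple_top_projective : projective (simple_mod \top%O).
Proof.
move=> M N g f g_surj; have [m gm] := g_surj (f (1 : K^o)).
pose m1 := act M (gen \top \top)%O m.
have m1_act x : act M x m1 = loop_coef \top%O x *: m1.
  by rewrite /m1 -ractM path_gen_top_mul actZ.
pose h (k : K^o) : M := k *: m1.
have h_lin : linear h by move=> k x y; rewrite /h scalerDl scalerA.
have h_act x k : h (act (simple_mod \top%O) x k) = act M x (h k).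
  by rewrite /h linearZ /= m1_act simple_actE scalerA mulrC.
exists (@fdhom_of _ _ _ (simple_mod \top%O) M _ h_lin h_act) => k.
rewrite fdhom_ofE /h linearZ /= /m1 hom_act gm -hom_act -linearZ /=.
by rewrite simple_actE loop_coef_gen eqxx mulr1 [k *: _]mulr1.
Qed.

(** A retraction of the embedding onto the line of [(bot -> top)] would have to
    vanish at [e_bot], hence at [(bot -> top) = e_bot (bot -> top)]. *)
Lemma simple_top_injective_trivial :
  injective_mod (simple_mod \top%O) -> \bot%O = \top%O :> L.
Proof.
move=> injS; apply/eqP/negPn/negP => bt.
pose i (k : K^o) : A := k *: gen \bot%O \top%O.
have i_lin : linear i by move=> k x y; rewrite /i scalerDl scalerA.
have i_act x k : i (act (simple_mod \top%O) x k) = act regular x (i k).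
  rewrite regular_actE simple_actE /i -scalerAl path_gen_top_mul.
  by rewrite scalerA mulrC.
pose g := @fdhom_of _ _ _ (simple_mod \top%O) regular _ i_lin i_act.
have [x y|r rP] := injS _ _ g (fdhom_id _).
  rewrite !fdhom_ofE /i => /ffunP/(_ (exist _ (\bot, \top)%O (lex1 _))).
  by rewrite !ffunE eqxx [LHS]mulr1 [RHS]mulr1.
have factor : act regular (gen \bot%O \top%O) (gen \bot%O \bot%O : A)
                = gen \bot%O \top%O.
  by rewrite regular_actE path_gen_mulE ?lex1 // eqxx.
have idem : act regular (gen \bot%O \bot%O) (gen \bot%O \bot%O : A)
              = gen \bot%O \bot%O.
  by rewrite regular_actE path_gen_mulE // eqxx.
have r0 : r (gen \bot%O \bot%O : A) = 0.
  rewrite -idem hom_act simple_actE loop_coef_gen eq_sym (negPf bt).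
  exact: mul0r.
have := rP (1 : K^o); rewrite fdhom_ofE /i scale1r -factor hom_act r0 linear0.
by move/esym/eqP; rewrite id_lfunE oner_eq0.
Qed.

(** When [bot = top], the algebra is [K], so linear maps are homomorphisms. *)
Lemma trivial_lattice_act M : #|L| = 1%N ->
  forall x m, act M x m = loop_coef \bot%O x *: m.
Proof.
move=> L1 x m; have all_eq a b : a = b.
  by apply: (fintype_le1P _ b a); rewrite L1.
move: x; apply: path_ind => [x y ex ey|k x ex|q|].
- by rewrite actD ex ey /loop_coef ffunE scalerDl.
- by rewrite actZ ex /loop_coef ffunE scalerA.
- rewrite loop_coef_gen (all_eq (src q) \bot%O) (all_eq (tgt q) \bot%O) eqxx.
  rewrite scale1r; suff <- : 1 = gen \bot%O \bot%O by exact: act1.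
  rewrite [LHS]/(path_one K L) /path_one (bigD1 \bot%O) //= big1 ?addr0 // => a.
  by rewrite (all_eq a \bot%O) eqxx.
- by rewrite act0 /loop_coef ffunE scale0r.
Qed.

Theorem path_algebra_quasi_Frobenius : quasi_Frobenius A <-> #|L| = 1%N.
Proof.
split=> [qF | L1 M].
  have bt := simple_top_injective_trivial ((qF _).1 simple_top_projective).
  apply/eqP/fintype1P; exists \bot%O => a.
  by apply/eqP; rewrite -lex0 bt lex1.
have lin_act (X Y : rmod) (r : 'Hom(X, Y)) x m :
    r (act X x m) = act Y x (r m).
  by rewrite !trivial_lattice_act // linearZ.
split=> _ X Y g f gP.
  have [r rK] := inj_hom_retract gP.
  by exists (FdHom (lin_act _ _ (f \o r)%VF)) => m /=; rewrite comp_lfunE rK.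
have [r rK] := surj_hom_section gP.
by exists (FdHom (lin_act _ _ (r \o f)%VF)) => m /=; rewrite comp_lfunE rK.
Qed.

End PathModules.

Theorem proposition5p18 (K : fieldType) (d : Order.disp_t)
    (L : finCTBDistrLatticeType d) :
  let A : falgType K := path_algebra K L in
  let phi : anti_automorphism A := complementation K L in
  [/\ equivalence (twisted_dual phi),
      (forall M : fdmod A RightSide,
         projective M <-> injective_mod (twisted_dual phi M)),
      QF2 A
    & quasi_Frobenius A <-> #|L| = 1%N].
Proof.
move=> A phi; have phiK : involutive phi := @compl_lfunK K d L.
split.
- exact: twisted_dual_equivalence.
- by move=> M; apply: projective_dual.
- exact: path_algebra_QF2.
- exact: path_algebra_quasi_Frobenius.
Qed.
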